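(* Let $n\ge 3$. Then $\operatorname{Det}(\mathrm{PX}(4,1))=6$ and $\operatorname{Dist}(\mathrm{PX}(4,1))=5$, and for all $n\neq 4$, $\operatorname{Det}(\mathrm{PX}(n,1))=n$ and $\operatorname{Dist}(\mathrm{PX}(n,1))=3$.
   Context: For integers $n\ge 3$ and $1\le k<n$, the Praeger–Xu graph $\mathrm{PX}(n,k)$ is the simple graph with vertex set $\mathbb Z_n\times\mathbb Z_2^k$; a vertex is written $(i,x)$ with $x=x_0x_1\cdots x_{k-1}$ a bitstring of length $k$. Two vertices $(i,x)$ and $(j,y)$ are adjacent if and only if (after possibly swapping the two vertices) $j=i+1$ in $\mathbb Z_n$ and $x=az_1\cdots z_{k-1}$, $y=z_1\cdots z_{k-1}b$ for some bits $a,b,z_1,\dots,z_{k-1}\in\mathbb Z_2$ (for $k=1$ this means $(i,x)$ is adjacent to both vertices $(i\pm1,0),(i\pm1,1)$). For a graph $G$, a set $S\subseteq V(G)$ is a determining set if the only automorphism of $G$ fixing every vertex of $S$ is the identity, and $\operatorname{Det}(G)$ is the minimum size of a determining set. $\operatorname{Dist}(G)$ is the least $d$ such that the vertices can be colored with $d$ colors so that the only automorphism preserving every color class setwise is the identity. *)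

(* Defs.v *)
From mathcomp Require Import all_boot all_order all_algebra all_fingroup.

Set Implicit Arguments.
Unset Strict Implicit.
Unset Printing Implicit Defensive.

(* A finite graph is given by its adjacency relation on a finType. *)
Section Graph.
Variables (T : finType) (e : rel T).

Definition graph_aut : {set {perm T}} :=
  [set s : {perm T} | [forall u, forall v, e (s u) (s v) == e u v]].

Definition determining (S : {set T}) : bool :=
  [forall s in graph_aut, [forall x in S, s x == x] ==> (s == 1%g)].

Definition color_class (d : nat) (c : {ffun T -> 'I_d}) (i : 'I_d) : {set T} :=
  [set x | c x == i].

Definition distinguishing (d : nat) (c : {ffun T -> 'I_d}) : bool :=
  [forall s in graph_aut,
     [forall i, s @: color_class c i == color_class c i] ==> (s == 1%g)].

Lemma ex_determining :
  exists m, [exists S : {set T}, determining S && (#|S| == m)].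
Proof.
exists #|[set: T]|; apply/existsP; exists [set: T]; rewrite eqxx andbT.
apply/forall_inP => s _; apply/implyP => /forall_inP fix_s.
by apply/eqP/permP => x; rewrite perm1; apply/eqP/fix_s.
Qed.

Lemma ex_distinguishing :
  exists d, [exists c : {ffun T -> 'I_d}, distinguishing c].
Proof.
exists #|T|; apply/existsP; exists [ffun x => enum_rank x].
apply/forall_inP => s _; apply/implyP => /forallP fix_s.
apply/eqP/permP => x; rewrite perm1.
have: s x \in s @: color_class [ffun x => enum_rank x] (enum_rank x).
  by apply: imset_f; rewrite inE ffunE.
by rewrite (eqP (fix_s _)) inE ffunE => /eqP/enum_rank_inj.
Qed.

Definition Det : nat := ex_minn ex_determining.
Definition Dist : nat := ex_minn ex_distinguishing.

End Graph.

Section PraegerXu.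
Local Open Scope ring_scope.

(* Only meaningful for 3 <= n and 1 <= k < n: 'Z_n is the ring Z/n only when
   1 < n. *)
Definition PX_vertex (n k : nat) : finType := ('Z_n * k.-tuple 'Z_2)%type.

Definition PX_arc (n k : nat) (u v : PX_vertex n k) : bool :=
  (v.1 == u.1 + 1) &&
  [exists a : 'Z_2, exists b : 'Z_2, exists z : k.-1.-tuple 'Z_2,
     (u.2 == a :: z :> seq 'Z_2) && (v.2 == rcons z b :> seq 'Z_2)].

Definition PX (n k : nat) : rel (PX_vertex n k) :=
  fun u v => PX_arc u v || PX_arc v u.

Lemma PX_sym n k : symmetric (@PX n k).
Proof. by move=> u v; rewrite /PX orbC. Qed.

Lemma PX_irrefl n k : irreflexive (@PX n k).
Proof.
move=> u; rewrite /PX orbb /PX_arc -[X in X == _]GRing.addr0.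
by rewrite (inj_eq (GRing.addrI _)) eq_sym GRing.oner_eq0.
Qed.

Lemma PX1E n (u v : PX_vertex n 1) :
  PX u v = (v.1 == u.1 + 1) || (u.1 == v.1 + 1).
Proof.
suff arcE (x y : PX_vertex n 1) : PX_arc x y = (y.1 == x.1 + 1).
  by rewrite /PX !arcE.
rewrite /PX_arc; case: eqP => //= _; apply/existsP.
exists (thead x.2); apply/existsP; exists (thead y.2); apply/existsP.
have tup1E (t : 1.-tuple 'Z_2) : t == [:: thead t] :> seq 'Z_2.
  by case/tupleP: t => a t; rewrite theadE tuple0.
by exists [tuple]; apply/andP; split; apply: tup1E.
Qed.

End PraegerXu.

Arguments PX n k : clear implicits.

(* Main.v *)
Require Import Defs.
From mathcomp Require Import all_boot all_order all_algebra all_fingroup.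
From mathcomp Require Import ring.

(* Swapping two twins (vertices with the same neighbours) is an automorphism, so
   a determining set misses at most one vertex of each twin class and a
   distinguishing coloring is injective on twin classes. For n <> 4 the twin
   classes of PX(n,1) are the n fibers over 'Z_n, each of size 2: one vertex per
   fiber is determining; with two colors, the color-preserving lift of the
   rotation is an automorphism; with three colors, label each fiber by its
   missing color and use the labels 0, 1, 2, ..., 2 around the cycle. The graph
   PX(4,1) is the complete bipartite graph K_{4,4}, whose twin classes are its
   two sides. *)

Set Implicit Arguments.
Unset Strict Implicit.
Unset Printing Implicit Defensive.

Import GRing.Theory.

(** * Determining sets, distinguishing colorings and twins in a general graph *)

Section Automorphisms.
Variables (T : finType) (e : rel T).

Lemma graph_autP (s : {perm T}) :
  reflect (forall u v, e (s u) (s v) = e u v) (s \in graph_aut e).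
Proof.
by rewrite inE; apply: (iffP 'forall_'forall_eqP).
Qed.

Lemma determiningP (S : {set T}) :
  reflect (forall s : {perm T}, s \in graph_aut e ->
             (forall x, x \in S -> s x = x) -> s = 1%g)
          (determining e S).
Proof.
apply: (iffP forall_inP) => [detS s aut_s fixS | detS s aut_s].
  by apply/eqP/(implyP (detS s aut_s))/forall_inP => x /fixS ->.
by apply/implyP => /forall_inP fixS; apply/eqP/detS => // x /fixS/eqP.
Qed.

Lemma distinguishingP d (c : {ffun T -> 'I_d}) :
  reflect (forall s : {perm T}, s \in graph_aut e ->
             (forall x, c (s x) = c x) -> s = 1%g)
          (distinguishing e c).
Proof.
apply: (iffP forall_inP) => [dist s aut_s fixc | dist s aut_s].
  apply/eqP/(implyP (dist s aut_s))/forallP => i.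
  rewrite eqEcard card_imset ?leqnn ?andbT; last exact: perm_inj.
  by apply/subsetP => _ /imsetP[x xi ->]; rewrite inE fixc; rewrite inE in xi.
apply/implyP => /forallP fixc; apply/eqP/dist => // x.
have: s x \in s @: color_class c (c x) by apply: imset_f; rewrite inE.
by rewrite (eqP (fixc _)) inE => /eqP.
Qed.

Lemma Det_eq m (S : {set T}) :
  determining e S -> #|S| = m ->
  (forall S' : {set T}, determining e S' -> m <= #|S'|) -> Det e = m.
Proof.
move=> detS Sm min_m; rewrite /Det; case: ex_minnP => k.
case/existsP => S' /andP[detS' /eqP <-] min_k.
apply/eqP; rewrite eqn_leq min_m // andbT min_k //.
by apply/existsP; exists S; rewrite detS Sm /=.
Qed.

Lemma Dist_eq d (c : {ffun T -> 'I_d}) :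
  distinguishing e c ->
  (forall d' (c' : {ffun T -> 'I_d'}), distinguishing e c' -> d <= d') ->
  Dist e = d.
Proof.
move=> distc min_d; rewrite /Dist; case: ex_minnP => k.
case/existsP => c' distc' min_k.
apply/eqP; rewrite eqn_leq (min_d _ _ distc') andbT min_k //.
by apply/existsP; exists c.
Qed.

Definition twins (x y : T) : Prop := e x =1 e y.

Hypothesis e_sym : symmetric e.

Lemma tperm_twins_aut x y : twins x y -> tperm x y \in graph_aut e.
Proof.
move=> xy; have fixl u v : e (tperm x y u) v = e u v.
  by case: tpermP => // ->; rewrite xy.
by apply/graph_autP => u v; rewrite fixl e_sym fixl e_sym.
Qed.

Lemma tperm1_eq (x y : T) : tperm x y = 1%g -> x = y.
Proof. by move/permP/(_ x); rewrite tpermL perm1. Qed.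

Lemma determining_twins (S : {set T}) x y :
  determining e S -> twins x y -> x \notin S -> y \notin S -> x = y.
Proof.
move=> /determiningP detS xy xS yS; apply/tperm1_eq/detS => [|z zS].
  exact: tperm_twins_aut.
by rewrite tpermD //; apply: contraNneq xS => xz; [rewrite xz|case/negP: yS; rewrite xz].
Qed.

Lemma distinguishing_twins d (c : {ffun T -> 'I_d}) x y :
  distinguishing e c -> twins x y -> c x = c y -> x = y.
Proof.
move=> /distinguishingP distc xy cxy; apply/tperm1_eq/distc => [|z].
  exact: tperm_twins_aut.
by case: tpermP => // ->.
Qed.

(** Automorphisms permute the twin classes. Surjectivity of [s] lets an arbitrary test vertex be
    written as an image. *)
Lemma aut_twins (s : {perm T}) x y :
  s \in graph_aut e -> twins (s x) (s y) <-> twins x y.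
Proof.
move/graph_autP=> aut_s; split=> xy v; first by rewrite -aut_s xy aut_s.
by rewrite -(permKV s v) !aut_s xy.
Qed.

End Automorphisms.

(** * Complete bipartite graphs with two sides of equal size *)

Section CompleteBipartite.
Variables (T : finType) (e : rel T) (p : pred T) (m : nat).
Hypothesis eE : forall u v, e u v = (p u != p v).
Hypothesis card_side : forall b, #|[set x | p x == b]| = m.
Hypothesis m_gt1 : 1 < m.

Lemma bipartite_sym : symmetric e.
Proof. by move=> u v; rewrite !eE eq_sym. Qed.

Lemma bipartite_twins x y : p x = p y -> twins e x y.
Proof. by move=> pxy v; rewrite !eE pxy. Qed.

Lemma bipartite_card : #|T| = m + m.
Proof.
rewrite -(cardC p) -{1}(card_side true) -(card_side false).
by congr addn; apply: eq_card => x; rewrite !inE -?topredE /=; case: (p x).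
Qed.

Lemma side_neq b : exists x y, [/\ p x = b, p y = b & x != y].
Proof.
have := m_gt1; rewrite -(card_side b) => /card_gt1P[x [y []]].
by rewrite !inE => /eqP px /eqP py xy; exists x, y.
Qed.

Lemma Det_bipartite : Det e = (m.-1).*2.
Proof.
(* The set [S] omits one vertex of each side. The spare vertex [a'] stays in [S] and keeps an
   automorphism from exchanging [a] and [b], since it is adjacent to [b] but not to [a]. *)
have [a [a' [pa pa' aa']]] := side_neq true.
have [b [_ [pb _ _]]] := side_neq false.
have ab : a != b by apply: contraFneq pb => <-.
pose S := ~: [set a; b].
apply: (@Det_eq _ e _ S).
- apply/determiningP => s /graph_autP aut_s fixS.
  have a'S : a' \in S.
    by rewrite !inE negb_or eq_sym aa'; apply: contraFneq pb => <-.
  have sab z : z \notin S -> s z \notin S.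
    by apply: contra => szS; rewrite -(perm_inj (fixS _ szS)).
  have sa : s a = a.
    have : s a \notin S by apply: sab; rewrite !inE eqxx.
    rewrite !inE negbK => /orP[/eqP //|/eqP sab'].
    by have := aut_s a a'; rewrite (fixS a' a'S) sab' !eE pa pa' pb.
  have sb : s b = b.
    have : s b \notin S by apply: sab; rewrite !inE eqxx orbT.
    rewrite !inE negbK => /orP[/eqP sba|/eqP //].
    by case/eqP: ab; apply: (@perm_inj _ s); rewrite sa sba.
  apply/permP => x; rewrite perm1.
  have [/fixS //|] := boolP (x \in S).
  by rewrite !inE negbK => /orP[] /eqP ->.
- rewrite cardsCs setCK bipartite_card cards2 ab.
  by rewrite -addnn; case: (m) m_gt1 => // k _; rewrite addSn addnS subSS subSS subn0.
move=> S' detS'.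
(* Two vertices of one side missed by [S'] would be twins, hence equal. *)
have side_le bb : m.-1 <= #|S' :&: [set x | p x == bb]|.
  rewrite setIC -(card_side bb) -(cardsID S' [set x | p x == bb]).
  set D := _ :\: _; suff : #|D| <= 1 by case: #|D| => [|[]] // _; rewrite ?addn0 ?addn1 ?leq_pred.
  apply/card_le1_eqP => x y; rewrite !inE => /andP[xS /eqP px] /andP[yS /eqP py].
  apply: (determining_twins bipartite_sym detS') => //.
  by apply: bipartite_twins; rewrite px py.
rewrite -addnn -(cardsID [set x | p x == true] S') leq_add //.
apply: leq_trans (side_le false) _; apply: subset_leq_card.
by apply/subsetP => x; rewrite !inE; case: (p x); rewrite ?andbF ?andbT.
Qed.

(** With at most [m] colors, injectivity on a side makes every color occur exactly once on each
    side. Matching equal colors across the two sides then gives a color-preserving automorphism that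
    swaps the sides. *)
Lemma bipartite_distinguishing_gt d (c : {ffun T -> 'I_d}) :
  distinguishing e c -> m < d.
Proof.
move=> distc; rewrite ltnNge; apply/negP => dm.
have c_inj x y : p x = p y -> c x = c y -> x = y.
  by move/bipartite_twins; apply: (distinguishing_twins bipartite_sym distc).
have c_onto b i : exists x, (p x == b) && (c x == i).
  have c_side : {in [set x | p x == b] &, injective c}.
    by move=> x y /[!inE] /eqP px /eqP py; apply: c_inj; rewrite px py.
  have : i \in c @: [set x | p x == b].
    rewrite (_ : c @: _ = setT) ?inE //; apply/eqP.
    by rewrite eqEcard subsetT card_in_imset // card_side cardsT card_ord.
  by case/imsetP => x /[!inE] px ->; exists x; rewrite px eqxx.
pose f v := xchoose (c_onto (~~ p v) (c v)).
have pf v : p (f v) = ~~ p v by case/andP: (xchooseP (c_onto (~~ p v) (c v))) => /eqP.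
have cf v : c (f v) = c v by case/andP: (xchooseP (c_onto (~~ p v) (c v))) => _ /eqP.
have f_inj : injective f.
  move=> u v fuv; apply: c_inj; last by rewrite -cf fuv cf.
  by apply: negb_inj; rewrite -!pf fuv.
have [x _] := side_neq true.
suff /permP/(_ x) : perm f_inj = 1%g.
  by rewrite permE perm1 => /(congr1 p); rewrite pf; case: (p x).
move/distinguishingP: distc; apply=> [|v]; last by rewrite permE.
by apply/graph_autP => u v; rewrite !permE !eE !pf (inj_eq negb_inj).
Qed.

Lemma Dist_bipartite : Dist e = m.+1.
Proof.
have [b [_ [pb _ _]]] := side_neq false.
pose rank v := index v (enum [set x | p x == p v]).
have rank_lt v : rank v < m by rewrite -(card_side (p v)) cardE index_mem mem_enum inE.
(* Ranks within a side stay below [m], so the color [ord_max] singles out [b]. An automorphism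
   preserving [c] therefore fixes [b] and cannot swap the sides. *)
pose c := [ffun v => if v == b then ord_max else inord (rank v) : 'I_m.+1].
apply: (@Dist_eq _ e _ c); last by move=> d c'; apply: bipartite_distinguishing_gt.
have cb v : c v = ord_max -> v = b.
  rewrite ffunE; case: eqP => // _ /(congr1 val) /=.
  by rewrite inordK ?leqW // => eqm; have := rank_lt v; rewrite eqm ltnn.
have c_inj x y : p x = p y -> c x = c y -> x = y.
  move=> pxy; have [->|xb] := eqVneq x b.
    by rewrite {1}ffunE eqxx => /esym/cb.
  have [->|yb] := eqVneq y b; first by rewrite [c b]ffunE eqxx => /cb.
  rewrite !ffunE (negPf xb) (negPf yb) => /(congr1 val) /=.
  rewrite !inordK ?leqW // /rank pxy => /(congr1 (nth x (enum [set z | p z == p y]))).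
  by rewrite !nth_index // mem_enum inE ?pxy.
apply/distinguishingP => s /graph_autP aut_s fixc.
have sb : s b = b by apply: cb; rewrite fixc ffunE eqxx.
apply/permP => x; rewrite perm1; apply: c_inj (fixc x).
by have := aut_s b x; rewrite sb !eE; case: (p b) (p x) (p (s x)) => [] [] [].
Qed.

End CompleteBipartite.

Lemma tuple1_Z2_cases (t : 1.-tuple 'Z_2) :
  t = [tuple 0%R] \/ t = [tuple 1%R].
Proof.
case/tupleP: t => -[[|[|//]] lt_a] t; rewrite tuple0; [left | right].
  by apply: val_inj; congr [:: _]; apply: val_inj.
by apply: val_inj; congr [:: _]; apply: val_inj.
Qed.

(** * The graphs PX(n,1) with n different from 4 *)

Section Cycle.
Variable n : nat.
Hypotheses (n_ge3 : 2 < n) (n_neq4 : n <> 4).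
Local Open Scope ring_scope.

Lemma Zn_2_neq0 : 2 != 0 :> 'Z_n.
Proof.
apply/eqP => two0; have := val_Zp_nat (ltnW n_ge3) 2.
by rewrite two0 modn_small.
Qed.

Lemma Zn_4_neq0 : 4 != 0 :> 'Z_n.
Proof.
apply/eqP => four0; have := val_Zp_nat (ltnW n_ge3) 4; rewrite four0.
(* Either n = 3, where 4 reduces to 1, or n > 4, where 4 is its own residue. *)
by case: n n_ge3 n_neq4 => [|[|[|[|[|k]]]]] // _ _; rewrite modn_small.
Qed.

Local Notation V := (PX_vertex n 1).
Local Notation t0 := ([tuple 0] : 1.-tuple 'Z_2).
Local Notation t1 := ([tuple 1] : 1.-tuple 'Z_2).

Lemma card_Zn : #|{: 'Z_n}| = n.
Proof. by rewrite card_ord Zp_cast // ltnW. Qed.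

(** Test the twins against the fibers over [u.1 + 1] and [u.1 - 1]. If [v] lies over another fiber,
    then [v.1] equals both [u.1 + 2] and [u.1 - 2], which forces 4 = 0. *)
Lemma PX1_twinsP (u v : V) : twins (PX n 1) u v <-> u.1 = v.1.
Proof.
split=> [uv | uv w]; last by rewrite !PX1E uv.
have := uv (u.1 + 1, t0); have := uv (u.1 - 1, t0).
rewrite !PX1E /= subrK !eqxx orbT /=.
case/esym/orP => [/eqP e1|/eqP-> //].
case/esym/orP => [/eqP/addIr //|/eqP e2].
case/eqP: Zn_4_neq0.
have -> : 4 = (v.1 + 1) - (u.1 - 1) - (v.1 - (u.1 + 1 + 1)) :> 'Z_n by ring.
by rewrite -e1 {1}e2 !subrr.
Qed.

Lemma PX1_aut_fiber (s : {perm V}) u v :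
  s \in graph_aut (PX n 1) -> (s u).1 = (s v).1 <-> u.1 = v.1.
Proof.
move=> aut_s; rewrite -PX1_twinsP -(PX1_twinsP u v).
exact: aut_twins.
Qed.

Lemma PX1_fiber_cases (u v w : V) :
  u.1 = w.1 -> v.1 = w.1 -> u != v -> w = u \/ w = v.
Proof.
case: u v w => [i a] [j b] [k c] /= -> ->.
by case: (tuple1_Z2_cases a) => ->; case: (tuple1_Z2_cases b) => ->;
   case: (tuple1_Z2_cases c) => -> //; rewrite ?eqxx //; auto.
Qed.

Lemma Det_PX1 : Det (PX n 1) = n.
Proof.
apply: (@Det_eq _ _ _ [set v : V | v.2 == t0]).
- apply/determiningP => s aut_s fixS; apply/permP => x; rewrite perm1.
  pose y : V := (x.1, t0); have sy : s y = y by apply: fixS; rewrite inE.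
  have [-> //|xy] := eqVneq x y.
  have sx1 : (s x).1 = x.1.
    by rewrite -[RHS]/(y.1) -sy; apply/PX1_aut_fiber.
  (* The image of [x] stays in the fiber [{x, y}], and [y] is already the image of itself. *)
  have [//|sxy] := PX1_fiber_cases (esym sx1) (esym sx1 : y.1 = _) xy.
  by case/eqP: xy; apply: (@perm_inj _ s); rewrite sy.
- rewrite (_ : [set _ | _] = setX setT [set t0]).
    by rewrite cardsX cardsT card_Zn cards1 muln1.
  by apply/setP => -[i t]; rewrite !inE.
(* A determining set meets every fiber, so its projection to ['Z_n] is onto. *)
move=> S detS; rewrite -{1}card_Zn -cardsT.
rewrite (leq_trans _ (leq_imset_card fst S)) // subset_leq_card //.
apply/subsetP => i _; apply/imsetP.
have [iS|i0] := boolP ((i, t0) \in S); first by exists (i, t0).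
have [iS|i1] := boolP ((i, t1) \in S); first by exists (i, t1).
have twin01 : twins (PX n 1) (i, t0) (i, t1) by apply/PX1_twinsP.
by have := determining_twins (@PX_sym n 1) detS twin01 i0 i1.
Qed.

Lemma PX1_distinguishing_gt d (c : {ffun V -> 'I_d}) :
  distinguishing (PX n 1) c -> (2 < d)%N.
Proof.
move=> distc; rewrite ltnNge; apply/negP => d2.
have c_inj (u v : V) : u.1 = v.1 -> c u = c v -> u = v.
  by move/PX1_twinsP; apply: (distinguishing_twins (@PX_sym n 1) distc).
have c_onto i k : exists x : V, (x.1 == i) && (c x == k).
  have c01 : c (i, t0) != c (i, t1) by apply/eqP => /c_inj -/(_ erefl).
  have : k \in [set c (i, t0); c (i, t1)].
    rewrite (_ : [set _; _] = setT) ?inE //; apply/eqP.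
    by rewrite eqEcard subsetT cards2 c01 cardsT card_ord.
  by rewrite !inE => /orP[] /eqP ->; [exists (i, t0) | exists (i, t1)];
    rewrite /= !eqxx.
(* Each fiber shows every color exactly once, so the rotation has a unique color-preserving lift
   [f]. *)
pose f (v : V) : V := xchoose (c_onto (v.1 + 1) (c v)).
have f1 v : (f v).1 = v.1 + 1.
  by case/andP: (xchooseP (c_onto (v.1 + 1) (c v))) => /eqP.
have cf v : c (f v) = c v.
  by case/andP: (xchooseP (c_onto (v.1 + 1) (c v))) => _ /eqP.
have f_inj : injective f.
  move=> u v fuv; apply: c_inj; last by rewrite -cf fuv cf.
  by apply: (addIr 1); rewrite -!f1 fuv.
suff /permP/(_ (0, t0))/(congr1 fst)/eqP : perm f_inj = 1%g.
  by rewrite permE perm1 f1 /= add0r oner_eq0.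
move/distinguishingP: distc; apply=> [|v]; last by rewrite permE.
by apply/graph_autP => u v; rewrite !permE !PX1E !f1 !(inj_eq (addIr 1)).
Qed.

(** The label of a fiber is implicit: each branch uses the two colors other than the label, which is
    0 over 0, 1 over 1, and 2 elsewhere. *)
Definition label_coloring : {ffun V -> 'I_3} :=
  [ffun v => if v.1 == 0 then (if v.2 == t0 then inord 1 else inord 2)
             else if v.1 == 1 then (if v.2 == t0 then inord 0 else inord 2)
             else (if v.2 == t0 then inord 0 else inord 1)].

Lemma label_coloring_inj (u v : V) :
  u.1 = v.1 -> label_coloring u = label_coloring v -> u = v.
Proof.
case: u v => [i a] [j b] /= ->; rewrite !ffunE /=.
case: (tuple1_Z2_cases a) => ->; case: (tuple1_Z2_cases b) => -> //=;
  by do !case: ifP => _ //; move/(congr1 val); rewrite /= !inordK.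
Qed.

(** The bound on [k] restricts to the labels 0 and 1, each carried by a single fiber; label 2 is
    given to all the remaining ones. *)
Lemma label_coloring_missing (i : 'Z_n) (k : nat) :
  (k < 2)%N -> (forall v : V, v.1 = i -> label_coloring v != k :> nat) ->
  i = k%:R.
Proof.
move=> k2 missing; have := missing (i, t1) erefl; have := missing (i, t0) erefl.
rewrite !ffunE /=.
case: k {missing} k2 => [|[|//]] _; (case: ifP => [/eqP -> | _];
  last case: ifP => [/eqP -> | _]); by rewrite //= !inordK.
Qed.

Lemma label_coloring_avoid (v : V) (k : nat) :
  (k < 2)%N -> v.1 = k%:R -> label_coloring v != k :> nat.
Proof.
case: k => [|[|//]] _ v1; rewrite ffunE v1 ?eqxx ?oner_eq0;
  by case: ifP => _; rewrite inordK.
Qed.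

Lemma label_coloring_distinguishing : distinguishing (PX n 1) label_coloring.
Proof.
apply/distinguishingP => s aut_s fixc.
pose f i := (s (i, t0)).1.
have sf v : (s v).1 = f v.1 by apply/PX1_aut_fiber.
have f_inj : injective f by move=> i j /(PX1_aut_fiber _ _ aut_s).
(* All vertices over [f k%:R] are images of vertices over [k%:R] with the same colors, so the
   missing color is carried along. *)
have fix_label (k : nat) : (k < 2)%N -> f k%:R = k%:R.
  move=> k2; apply: label_coloring_missing => // v v1.
  rewrite -(permKV s v) fixc; apply: label_coloring_avoid => //.
  by apply: f_inj; rewrite -sf permKV.
(* Two consecutive fixed fibers propagate around the cycle: [f] sends i + 2 to a neighbour of i + 1,
   and the neighbour i is already taken by the image of i, as 2 is nonzero. *)
have fix_pair i : f (i%:R) = i%:R /\ f (i.+1%:R) = i.+1%:R.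
  elim: i => [|i [fi fi1]].
    by split; apply: fix_label.
  split=> //; have /graph_autP/(_ (i.+1%:R, t0) (i.+2%:R, t0)) := aut_s.
  rewrite !PX1E !sf /= fi1 -(natr1 i.+1) eqxx /= => /orP[/eqP //|/eqP fi2].
  have : f (i.+1%:R + 1) = f i%:R.
    by rewrite fi; apply: (addIr 1); rewrite -fi2 natr1.
  move/f_inj/eqP; rewrite -natr1 -addrA -subr_eq0 addrAC subrr add0r.
  by rewrite (negPf Zn_2_neq0).
apply/permP => x; rewrite perm1; apply: label_coloring_inj (fixc x).
(* Every residue is the image of its natural representative, so the induction on naturals reaches
   all fibers. *)
by rewrite sf -[x.1]natr_Zp; case: (fix_pair x.1).
Qed.

Lemma Dist_PX1 : Dist (PX n 1) = 3.
Proof.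
apply: Dist_eq label_coloring_distinguishing _ => d c.
exact: PX1_distinguishing_gt.
Qed.

End Cycle.

(** * The exceptional graph PX(4,1) and the conclusion *)

Lemma PX41E (u v : PX_vertex 4 1) : PX 4 1 u v = (odd u.1 != odd v.1).
Proof.
(* Modulo 4, the residues i + 1 and i - 1 are exactly those of parity opposite to i; this is checked
   case by case. *)
rewrite PX1E; case: u v => [[i lt_i] a] [[j lt_j] b] /=.
by move: i j lt_i lt_j; do 4?[case=> //]; do 4?[case=> //].
Qed.

Lemma PX41_side b : #|[set v : PX_vertex 4 1 | odd v.1 == b]| = 4.
Proof.
rewrite (_ : [set _ | _] = setX [set i : 'Z_4 | odd i == b] setT); last first.
  by apply/setP => -[i t]; rewrite !inE andbT.
rewrite cardsX cardsT card_tuple card_ord -sum1dep_card big_mkcond.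
by rewrite !big_ord_recl big_ord0; case: b.
Qed.

Theorem theorem3p4 :
  (Det (PX 4 1) = 6 /\ Dist (PX 4 1) = 5) /\
  (forall n : nat, 3 <= n -> n <> 4 ->
     Det (PX n 1) = n /\ Dist (PX n 1) = 3).
Proof.
split=> [|n n_ge3 n_neq4]; last by rewrite Det_PX1 // Dist_PX1.
(* With sides of size 4 the values are 2(4 - 1) = 6 and 4 + 1 = 5. *)
by rewrite (Det_bipartite PX41E PX41_side) // (Dist_bipartite PX41E PX41_side).
Qed.
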